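(* Let $H$ be a finite dimensional cosemisimple Hopf algebra over $\mathbb{C}$ and let $K, L$ be two Hopf subalgebras of $H$ such that $KL=LK$. If $M$ is a $K$-module then $$M\!\uparrow_K^{LK}\downarrow_L\;\cong\;(M\!\downarrow_{L\cap K})\!\uparrow^L$$ as left $L$-modules.
   Context: $LK$ denotes the linear span of products $xy$ with $x\in L$, $y\in K$ (and similarly for $KL$). Here $M\!\uparrow_K^{LK}\downarrow_L=LK\otimes_K M$ regarded as a left $L$-module, and $(M\!\downarrow_{L\cap K})\!\uparrow^L=L\otimes_{L\cap K}M$. Over $\mathbb{C}$ a finite dimensional Hopf algebra is cosemisimple if and only if it is semisimple. *)

(* Defs.v *)
From HB Require Import structures.
From mathcomp Require Import all_boot all_order all_algebra all_field.
From mathcomp Require Import boolp.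

Set Implicit Arguments.
Unset Strict Implicit.
Unset Printing Implicit Defensive.

Import GRing.Theory.

Local Open Scope ring_scope.

(* The tensor product over a field of two finite dimensional spaces: matrices *)
(* of coordinates on the products of the vectors of the reference bases. The  *)
(* lemmas in the next section are its universal property.                     *)
Definition tens (F : fieldType) (V W : vectType F) :=
  'M[F]_(\dim {:V}, \dim {:W}).
HB.instance Definition _ (F : fieldType) (V W : vectType F) :=
  Vector.on (tens V W).

Section TensorOverField.

Variables (F : fieldType) (V W : vectType F).

Definition refb (U : vectType F) (i : 'I_(\dim {:U})) : U := (vbasis {:U})`_i.

Definition pure (v : V) (w : W) : tens V W :=
  \matrix_(i, j) (coord (vbasis {:V}) i v * coord (vbasis {:W}) j w).

(* If t = sum_k v_k (x) w_k, then tlift phi t = sum_k phi v_k w_k for every   *)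
(* bilinear phi; thus tlift phi (comul h) is phi h_(1) h_(2) in Sweedler      *)
(* notation.                                                                  *)
Definition tlift (U : lmodType F) (phi : V -> W -> U) (t : tens V W) : U :=
  \sum_i \sum_j t i j *: phi (refb i) (refb j).

Definition tensv (A : {vspace V}) (B : {vspace W}) : {vspace tens V W} :=
  <<[seq pure a b | a <- vbasis A, b <- vbasis B]>>%VS.

Lemma refb_sum (U : vectType F) (u : U) :
  u = \sum_i coord (vbasis {:U}) i u *: refb i.
Proof. exact: coord_vbasis (memvf u). Qed.

Lemma coord_refb (U : vectType F) (i j : 'I_(\dim {:U})) :
  coord (vbasis {:U}) i (refb j) = (i == j)%:R.
Proof. by rewrite coord_free ?(basis_free (vbasisP _)) // eq_sym. Qed.

Lemma pure_linearl w : linear (pure^~ w).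
Proof.
by move=> c v v'; apply/matrixP=> i j; rewrite !mxE linearP mulrDl mulrA.
Qed.

Lemma pure_linearr v : linear (pure v).
Proof.
by move=> c w w'; apply/matrixP=> i j; rewrite !mxE linearP mulrDr mulrCA.
Qed.

Lemma tlift_linear (U : lmodType F) (phi : V -> W -> U) : linear (tlift phi).
Proof.
move=> c t t'; rewrite /tlift scaler_sumr -big_split; apply: eq_bigr => i _.
rewrite scaler_sumr -big_split; apply: eq_bigr => j _.
by rewrite !mxE scalerDl scalerA.
Qed.

Lemma tlift_pure (U : lmodType F) (phi : V -> W -> U) :
    (forall w, linear (phi^~ w)) -> (forall v, linear (phi v)) ->
  forall v w, tlift phi (pure v w) = phi v w.
Proof.
move=> linl linr v w.
pose fl w' : {linear V -> U} :=
  HB.pack (phi^~ w') (GRing.isLinear.Build _ _ _ _ _ (linl w')).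
pose fr v' : {linear W -> U} :=
  HB.pack (phi v') (GRing.isLinear.Build _ _ _ _ _ (linr v')).
rewrite -[RHS]/(fl w v) [in RHS](refb_sum v) linear_sum; apply: eq_bigr => i _.
rewrite linearZ /= -[phi _ w]/(fr (refb i) w) [in RHS](refb_sum w) linear_sum.
rewrite scaler_sumr; apply: eq_bigr => j _.
by rewrite linearZ /= scalerA mxE.
Qed.

Lemma tens_sum (t : tens V W) :
  t = \sum_i \sum_j t i j *: pure (refb i) (refb j).
Proof.
rewrite [LHS]matrix_sum_delta; apply: eq_bigr => i _; apply: eq_bigr => j _.
by congr (_ *: _); apply/matrixP=> i' j'; rewrite !mxE !coord_refb -natrM mulnb.
Qed.

End TensorOverField.

Notation "v '\ox' w" := (pure v w) (at level 40, left associativity).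

HB.mixin Record Falgebra_isHopf (F : fieldType) H of Falgebra F H := {
  comul : 'Hom(H, tens H H);
  counit : 'Hom(H, F^o);
  antipode : 'End(H);
  comulA : forall h : H,
    tlift (fun a b => comul a \ox b) (comul h)
    = tlift (fun a b => tlift (fun b1 b2 => (a \ox b1) \ox b2) (comul b))
            (comul h);
  counitl : forall h : H, tlift (fun a b => counit a *: b) (comul h) = h;
  counitr : forall h : H, tlift (fun a b => counit b *: a) (comul h) = h;
  comul1 : comul 1 = 1 \ox 1;
  comulM : forall g h : H,
    comul (g * h)
    = tlift (fun a b => tlift (fun c d => (a * c) \ox (b * d)) (comul h))
            (comul g);
  counit1 : counit 1 = 1;
  counitM : forall g h : H, counit (g * h) = counit g * counit h;
  antipodel : forall h : H,
    tlift (fun a b => antipode a * b) (comul h) = counit h *: 1;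
  antipoder : forall h : H,
    tlift (fun a b => a * antipode b) (comul h) = counit h *: 1
}.

#[short(type="hopfAlgType")]
HB.structure Definition HopfAlgebra (F : fieldType) :=
  { H of Falgebra_isHopf F H & Falgebra F H }.

Section Cosemisimple.

Variables (F : fieldType) (H : hopfAlgType F).

Definition subcoalgebra (D : {vspace H}) : Prop :=
  (comul @: D <= tensv D D)%VS.

Definition simple_subcoalgebra (D : {vspace H}) : Prop :=
  [/\ subcoalgebra D, D <> 0%VS
    & forall E : {vspace H},
        subcoalgebra E -> (E <= D)%VS -> E = 0%VS \/ E = D].

(* H is the sum of its simple subcoalgebras, i.e., equals its coradical.      *)
Definition cosemisimple : Prop :=
  exists2 Ds : seq {vspace H},
    (forall D, D \in Ds -> simple_subcoalgebra D)
    & (\sum_(D <- Ds) D)%VS = fullv.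

End Cosemisimple.

Arguments cosemisimple {F} H.

(* The unit algid A of A : {aspace aT} need not be 1, whence the condition.   *)
Record usubalg (F : fieldType) (aT : falgType F) := USubalg {
  usubalg_val :> {aspace aT};
  usubalg1 : 1 \in usubalg_val
}.

Definition hopf_subalgebra (F : fieldType) (H : hopfAlgType F)
    (K : usubalg H) : Prop :=
  subcoalgebra (K : {vspace H}) /\ (antipode @: K <= K)%VS.

Section UnitalSubalgebras.

Variables (F : fieldType) (aT : falgType F).
Implicit Types A B : usubalg aT.

Fact ucap_subproof A B : is_aspace (A :&: B).
Proof.
by rewrite /is_aspace has_algid1 ?memv_cap ?usubalg1 //= subv_cap
  !prodv_sub ?capvSl ?capvSr.
Qed.

Definition ucap A B : usubalg aT :=
  @USubalg F aT (ASpace (ucap_subproof A B))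
    (introT memv_capP (conj (usubalg1 A) (usubalg1 B))).

Fact uprod_mem1 A B : 1 \in (A * B)%VS.
Proof. by rewrite -[1]mulr1 memv_mul ?usubalg1. Qed.

Fact uprod_subproof A B : (B * A = A * B)%VS -> is_aspace (A * B).
Proof.
move=> eqBA; rewrite /is_aspace has_algid1 ?uprod_mem1 //=.
by rewrite prodvA -(prodvA A B A) eqBA prodvA prodv_id -prodvA prodv_id.
Qed.

Definition uprod A B (eqBA : (B * A = A * B)%VS) : usubalg aT :=
  @USubalg F aT (ASpace (uprod_subproof eqBA)) (uprod_mem1 A B).

Lemma uprod_subl A B (eqBA : (B * A = A * B)%VS) : (A <= uprod eqBA)%VS.
Proof. by apply/subvP=> a Aa; rewrite -[a]mulr1 memv_mul ?usubalg1. Qed.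

Lemma uprod_subr A B (eqBA : (B * A = A * B)%VS) : (B <= uprod eqBA)%VS.
Proof. by apply/subvP=> b Bb; rewrite -[b]mul1r memv_mul ?usubalg1. Qed.

Lemma ucap_subl A B : (ucap A B <= A)%VS. Proof. exact: capvSl. Qed.

Lemma ucap_subr A B : (ucap A B <= B)%VS. Proof. exact: capvSr. Qed.

Definition incl A B (sAB : (A <= B)%VS) (x : subvs_of A) : subvs_of B :=
  Subvs (subvP sAB _ (subvsP x)).

Variables (A B : usubalg aT) (sAB : (A <= B)%VS).

Fact incl_zmod_morphism : zmod_morphism (incl sAB).
Proof. by move=> x y; apply: val_inj. Qed.

Fact incl_monoid_morphism : monoid_morphism (incl sAB).
Proof.
split=> [|x y]; apply: val_inj => //=.
have /eqP-> : algid A == 1 by rewrite algid_eq1 usubalg1.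
by apply/esym/eqP; rewrite algid_eq1 usubalg1.
Qed.

HB.instance Definition _ :=
  GRing.isZmodMorphism.Build (subvs_of A) (subvs_of B) (incl sAB)
    incl_zmod_morphism.
HB.instance Definition _ :=
  GRing.isMonoidMorphism.Build (subvs_of A) (subvs_of B) (incl sAB)
    incl_monoid_morphism.

End UnitalSubalgebras.

Definition resm (A B : nzRingType) (f : {rmorphism B -> A}) (N : lmodType A) :
  Type := N.

Section Restriction.

Variables (A B : nzRingType) (f : {rmorphism B -> A}) (N : lmodType A).

HB.instance Definition _ := GRing.Zmodule.copy (resm f N) N.

Definition resm_scale (b : B) (n : resm f N) : resm f N := f b *: (n : N).

Fact resm_scaleA a b n : resm_scale a (resm_scale b n) = resm_scale (a * b) n.
Proof. by rewrite /resm_scale rmorphM scalerA. Qed.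
Fact resm_scale1 : left_id 1 resm_scale.
Proof. by move=> n; rewrite /resm_scale rmorph1 scale1r. Qed.
Fact resm_scaleDr : right_distributive resm_scale +%R.
Proof. by move=> b n n'; apply: scalerDr. Qed.
Fact resm_scaleDl n : {morph resm_scale^~ n : a b / a + b}.
Proof. by move=> a b; rewrite /resm_scale rmorphD scalerDl. Qed.

HB.instance Definition _ := GRing.Zmodule_isLmodule.Build B (resm f N)
  resm_scaleA resm_scale1 resm_scaleDr resm_scaleDl.

End Restriction.

Section Induction.

Variables (A B : nzRingType) (f : {rmorphism B -> A}) (M : lmodType B).

(* A (x)_B M: formal sums of symbols a (x) m, here sequences of pairs, modulo *)
(* the congruence generated by the defining relations of the tensor product.  *)
Inductive ind_eq : seq (A * M) -> seq (A * M) -> Prop :=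
| ind_refl s : ind_eq s s
| ind_sym s t : ind_eq s t -> ind_eq t s
| ind_trans s t u : ind_eq s t -> ind_eq t u -> ind_eq s u
| ind_cat s s' t t' : ind_eq s s' -> ind_eq t t' -> ind_eq (s ++ t) (s' ++ t')
| ind_catC s t : ind_eq (s ++ t) (t ++ s)
| ind_zero m : ind_eq [:: (0, m)] [::]
| ind_addl a a' m : ind_eq [:: (a + a', m)] [:: (a, m); (a', m)]
| ind_addr a m m' : ind_eq [:: (a, m + m')] [:: (a, m); (a, m')]
| ind_bal a b m : ind_eq [:: (a * f b, m)] [:: (a, b *: m)].

Definition ind_eqb (s t : seq (A * M)) : bool := `[< ind_eq s t >].

Fact ind_eqb_refl : reflexive ind_eqb.
Proof. by move=> s; apply/asboolP/ind_refl. Qed.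
Fact ind_eqb_sym : symmetric ind_eqb.
Proof. by move=> s t; apply/asboolP/asboolP=> /ind_sym. Qed.
Fact ind_eqb_trans : transitive ind_eqb.
Proof.
by move=> t s u /asboolP st /asboolP tu; apply/asboolP/(ind_trans st tu).
Qed.
Canonical ind_equiv := EquivRel ind_eqb ind_eqb_refl ind_eqb_sym ind_eqb_trans.

Definition indm : Type := {eq_quot ind_equiv}%qT.
HB.instance Definition _ := Choice.on indm.

Definition ind_class (s : seq (A * M)) : indm := (\pi_({eq_quot ind_equiv}) s)%qT.

Lemma ind_classP s t : ind_class s = ind_class t <-> ind_eq s t.
Proof.
split=> [/(@eqmodP _ ind_equiv)/asboolP // | st].
exact/(@eqmodP _ ind_equiv)/asboolP.
Qed.

Definition ind_repr (x : indm) : seq (A * M) :=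
  repr (x : {eq_quot ind_equiv}%qT).

Lemma ind_reprK : cancel ind_repr ind_class.
Proof. by move=> x; rewrite /ind_class /ind_repr reprK. Qed.

Lemma ind_reprP s : ind_eq (ind_repr (ind_class s)) s.
Proof. by apply/ind_classP; rewrite ind_reprK. Qed.

Lemma indmP (x : indm) : exists s, x = ind_class s.
Proof. by exists (ind_repr x); rewrite ind_reprK. Qed.

Definition ind_mulseq (a : A) (s : seq (A * M)) := [seq (a * p.1, p.2) | p <- s].

Lemma ind_mulseq_eq a s t : ind_eq s t -> ind_eq (ind_mulseq a s) (ind_mulseq a t).
Proof.
rewrite /ind_mulseq; elim=> {s t} /=.
- by move=> s; apply: ind_refl.
- by move=> s t _; apply: ind_sym.
- by move=> s t u _ st _; apply: ind_trans.
- by move=> s s' t t' _ st _ st'; rewrite !map_cat; apply: ind_cat.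
- by move=> s t; rewrite !map_cat; apply: ind_catC.
- by move=> m; rewrite mulr0; apply: ind_zero.
- by move=> b b' m; rewrite mulrDr; apply: ind_addl.
- by move=> b m m'; apply: ind_addr.
- by move=> c b m; rewrite mulrA; apply: ind_bal.
Qed.

Definition ind_add (x y : indm) : indm := ind_class (ind_repr x ++ ind_repr y).
Definition ind_opp (x : indm) : indm := ind_class (ind_mulseq (- 1) (ind_repr x)).
Definition ind_scale (a : A) (x : indm) : indm :=
  ind_class (ind_mulseq a (ind_repr x)).

Lemma ind_addE s t : ind_add (ind_class s) (ind_class t) = ind_class (s ++ t).
Proof. by apply/ind_classP/ind_cat; apply: ind_reprP. Qed.

Lemma ind_scaleE a s : ind_scale a (ind_class s) = ind_class (ind_mulseq a s).
Proof. exact/ind_classP/ind_mulseq_eq/ind_reprP. Qed.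

Lemma ind_oppE s : ind_opp (ind_class s) = ind_class (ind_mulseq (- 1) s).
Proof. exact: ind_scaleE. Qed.

Fact ind_addA : associative ind_add.
Proof.
move=> x y z; have [[s ->] [[t ->] [u ->]]] := (indmP x, (indmP y, indmP z)).
by rewrite !ind_addE catA.
Qed.
Fact ind_addC : commutative ind_add.
Proof.
move=> x y; have [[s ->] [t ->]] := (indmP x, indmP y).
by rewrite !ind_addE; apply/ind_classP/ind_catC.
Qed.
Fact ind_add0 : left_id (ind_class [::]) ind_add.
Proof. by move=> x; have [s ->] := indmP x; rewrite ind_addE. Qed.

Lemma ind_scaleDl_seq a b s :
  ind_eq (ind_mulseq (a + b) s) (ind_mulseq a s ++ ind_mulseq b s).
Proof.
elim: s => [|[c m] s IHs] /=; first exact: ind_refl.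
rewrite mulrDl.
have := ind_cat (ind_addl (a * c) (b * c) m) IHs; move/ind_trans; apply.
have := ind_cat (ind_refl [:: (a * c, m)])
  (ind_cat (ind_catC [:: (b * c, m)] (ind_mulseq a s))
           (ind_refl (ind_mulseq b s))).
by rewrite -[(ind_mulseq a s ++ _) ++ _]catA.
Qed.

Lemma ind_mulseq0 s : ind_eq (ind_mulseq 0 s) [::].
Proof.
elim: s => [|[c m] s IHs] /=; first exact: ind_refl.
by rewrite mul0r -cat1s; apply: (ind_cat (ind_zero _) IHs).
Qed.

Lemma ind_mulseq1 s : ind_mulseq 1 s = s.
Proof. by rewrite -[RHS]map_id; apply: eq_map => -[a m] /=; rewrite mul1r. Qed.

Fact ind_addN : left_inverse (ind_class [::]) ind_opp ind_add.
Proof.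
move=> x; have [s ->] := indmP x; rewrite ind_oppE ind_addE; apply/ind_classP.
rewrite -{2}[s]ind_mulseq1; apply: ind_trans (ind_sym (ind_scaleDl_seq _ _ _)) _.
by rewrite addNr; apply: ind_mulseq0.
Qed.

HB.instance Definition _ :=
  GRing.isZmodule.Build indm ind_addA ind_addC ind_add0 ind_addN.

Fact ind_scaleA a b x : ind_scale a (ind_scale b x) = ind_scale (a * b) x.
Proof.
have [s ->] := indmP x; rewrite !ind_scaleE /ind_mulseq -map_comp.
by congr ind_class; apply: eq_map => -[c m] /=; rewrite mulrA.
Qed.
Fact ind_scale1 : left_id 1 ind_scale.
Proof. by move=> x; have [s ->] := indmP x; rewrite ind_scaleE ind_mulseq1. Qed.
Fact ind_scaleDr : right_distributive ind_scale +%R.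
Proof.
move=> a x y; have [[s ->] [t ->]] := (indmP x, indmP y).
by rewrite -[_ + _ in LHS]/(ind_add _ _) -[RHS]/(ind_add _ _)
  !(ind_addE, ind_scaleE) /ind_mulseq map_cat.
Qed.
Fact ind_scaleDl x : {morph ind_scale^~ x : a b / a + b}.
Proof.
move=> a b; have [s ->] := indmP x.
rewrite -[RHS]/(ind_add _ _) !ind_scaleE ind_addE.
exact/ind_classP/ind_scaleDl_seq.
Qed.

HB.instance Definition _ := GRing.Zmodule_isLmodule.Build A indm
  ind_scaleA ind_scale1 ind_scaleDr ind_scaleDl.

Definition indt (a : A) (m : M) : indm := ind_class [:: (a, m)].

Lemma indtDl m : {morph indt^~ m : a b / a + b}.
Proof.
move=> a b; rewrite -[RHS]/(ind_add _ _) ind_addE.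
exact/ind_classP/ind_addl.
Qed.

Lemma indtDr a : {morph indt a : m n / m + n}.
Proof.
move=> m n; rewrite -[RHS]/(ind_add _ _) ind_addE.
exact/ind_classP/ind_addr.
Qed.

Lemma indt_bal a b m : indt (a * f b) m = indt a (b *: m).
Proof. exact/ind_classP/ind_bal. Qed.

Lemma indtZ a b m : a *: indt b m = indt (a * b) m.
Proof. exact: ind_scaleE. Qed.

Lemma ind_classE s : ind_class s = \sum_(p <- s) indt p.1 p.2.
Proof.
elim: s => [|[a m] s IHs]; first by rewrite big_nil.
by rewrite big_cons -IHs -[RHS]/(ind_add _ _) ind_addE.
Qed.

Lemma indm_lift (G : zmodType) (phi : A -> M -> G) :
    (forall m, {morph phi^~ m : a b / a + b}) ->
    (forall a, {morph phi a : m n / m + n}) ->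
    (forall a b m, phi (a * f b) m = phi a (b *: m)) ->
  exists g : {additive indm -> G}, forall a m, g (indt a m) = phi a m.
Proof.
move=> phiDl phiDr phi_bal.
pose ev s := \sum_(p <- s) phi p.1 p.2.
have phi0 m : phi 0 m = 0.
  by apply: (addrI (phi 0 m)); rewrite -phiDl !addr0.
have evP s t : ind_eq s t -> ev s = ev t.
  rewrite /ev; elim=> {s t} //=.
  - by move=> s t u _ -> _ ->.
  - by move=> s s' t t' _ st _ st'; rewrite !big_cat /= st st'.
  - by move=> s t; rewrite !big_cat /= addrC.
  - by move=> m; rewrite big_seq1 big_nil phi0.
  - by move=> a a' m; rewrite !big_cons !big_nil /= !addr0 phiDl.
  - by move=> a m m'; rewrite !big_cons !big_nil /= !addr0 phiDr.
  - by move=> a b m; rewrite !big_seq1 phi_bal.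
pose g x := ev (ind_repr x).
have gE s : g (ind_class s) = ev s by apply/evP/ind_reprP.
have g_nmod : nmod_morphism g.
  split=> [|x y]; first by rewrite -[0]/(ind_class [::]) gE /ev big_nil.
  have [[s ->] [t ->]] := (indmP x, indmP y).
  by rewrite -[_ + _ in LHS]/(ind_add _ _) ind_addE !gE /ev big_cat.
pose ga : {additive indm -> G} :=
  HB.pack g (GRing.isNmodMorphism.Build _ _ g g_nmod).
by exists ga => a m; rewrite /= gE /ev big_seq1.
Qed.

Lemma indm_ext (G : zmodType) (g h : {additive indm -> G}) :
  (forall a m, g (indt a m) = h (indt a m)) -> g =1 h.
Proof.
move=> eq_gh x; have [s ->] := indmP x; rewrite ind_classE !raddf_sum.
exact: eq_bigr.
Qed.

End Induction.

(* Main.v *)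
Require Import Defs.
From HB Require Import structures.
From mathcomp Require Import all_boot all_order all_algebra all_field.
From mathcomp Require Import reals complex ring zify.
From mathcomp Require boolp.

(* For Hopf subalgebras the natural map L (x)_(L n K) M -> LK (x)_K M is      *)
(* inverted by means of a dual basis. Cosemisimplicity gives a complementary  *)
(* subcoalgebra of K; let p be counit on K and 0 on this complement. Then     *)
(* pi h = p h_(1) h_(2) = h_(1) p h_(2) is a right K-linear projection onto K *)
(* that preserves L. If y in L satisfies p (y l) = counit l for all l in L,   *)
(* then S y_(1) pi (y_(2) l) = l, so that                                     *)
(*   x (x) m |-> S y_(1) (x) pi (y_(2) x) m                                   *)
(* is the inverse sought.                                                     *)
(* To find y, let tau y be the convolution operator h |-> h_(1) p (y h_(2)).  *)
(* The operators tau y for y in L form an algebra W, possibly without unit;   *)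
(* take an idempotent e = tau y of W such that (1 - e) W (1 - e) is           *)
(* nilpotent. On L (x) H the idempotents E : x (x) h |-> x_(1) (x)            *)
(* tau (y x_(2)) h and 1 (x) e are conjugate under the bijection              *)
(* x (x) h |-> x_(1) (x) x_(2) h, hence have the same rank, and by nilpotency *)
(* 1 (x) e is injective on the image of E. So 1 (x) e and (1 (x) e) E have    *)
(* the same image, and applying x (x) h |-> p h x shows that e is the         *)
(* identity on L, which means p (y l) = counit l.                             *)

Set Implicit Arguments.
Unset Strict Implicit.
Unset Printing Implicit Defensive.

Import GRing.Theory FalgLfun.

Local Open Scope ring_scope.

(** * Idempotents in algebras of operators *)

(** The aim is to recover every l in L from finitely many values of pi: once l is the sum of a pi (b
    l) over fixed pairs (a, b) in L, right K-linearity of pi extends this to LK, and the isomorphism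
    is formal ([mackey_of_dual_basis]). [hopf_subalgebra_functional] supplies p, hence pi; the pairs
    come from the coproduct of y ([retraction_dual_basis]).

    The hard part is y ([translate_eq_counit]): some [tau y] with y in L must be the identity on L.
    These operators are closed under composition by [tau_tau]. A multiplicatively closed space of
    operators either acts nilpotently or contains one fixing a nonzero vector
    ([act_nil_or_fixpoint]), and a fixed vector yields an idempotent ([idempotent_of_fixpoint]), so
    idempotents can be enlarged until the corner (1 - e) W (1 - e) is nilpotent
    ([maximal_idempotent]). Nilpotency is then used twice: to get p y = 1 ([p_idempotent]), and in a
    dimension count on L (x) H that forces e to fix L. *)

Lemma annihilating_poly (F : fieldType) (aT : falgType F) (r : 'End(aT)) :
  exists2 P : {poly F}, P != 0 & horner_alg r P = 0.
Proof.
pose n := (\dim {:'End(aT)}).+1.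
pose g (c : 'rV[F]_n) : 'End(aT) := horner_alg r (rVpoly c).
have g_lin : linear g.
  by move=> a c d; rewrite /g !linearP /= mulr_algl.

pose gl : {linear 'rV[F]_n -> 'End(aT)} :=
  HB.pack g (GRing.isLinear.Build F 'rV[F]_n 'End(aT) *:%R g g_lin).
have ker_n0 : lker (linfun gl) != 0%VS.
  apply/eqP=> ker0.
  have := limg_ker_dim (linfun gl) fullv.
  rewrite ker0 capv0 dimv0 add0n dimvf /dim /= mul1n => dim_img.
  have := dimvS (subvf (limg (linfun gl))); rewrite dim_img.
  by rewrite ltnn.
exists (rVpoly (vpick (lker (linfun gl)))).
  apply: contraNneq ker_n0 => v0; rewrite -vpick0.
  by rewrite -[vpick _]rVpolyK v0 linear0.
by have := memv_pick (lker (linfun gl)); rewrite memv_ker lfunE /= => /eqP.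
Qed.

Lemma horner_alg_fix (F : fieldType) (aT : falgType F) (r : 'End(aT)) x P :
  r x = x -> horner_alg r P x = P.[1] *: x.
Proof.
move=> rx; elim/poly_ind: P => [|P c IHP].
  by rewrite !linear0 lfunE horner0 scale0r.
rewrite linearD rmorphM /= horner_algX horner_algC !hornerE add_lfunE lfun_mulE.
by rewrite IHP linearZ /= rx scale_lfunE lfunE /= scalerDl.
Qed.

(* The idempotent is a polynomial in r without constant term, congruent to 1  *)
(* modulo the primary factor at 1 of an annihilating polynomial of r and to 0 *)
(* modulo the cofactor.                                                       *)
Lemma idempotent_of_fixpoint (F : fieldType) (aT : falgType F)
    (R : {vspace 'End(aT)}) (r : 'End(aT)) (x : aT) :
    (forall u v, u \in R -> v \in R -> (u \o v)%VF \in R) ->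
    r \in R -> r x = x ->
  exists f, [/\ f \in R, (f \o f)%VF = f & f x = x].
Proof.
move=> R_mul Rr rx.
have [P P_neq0 Pr] := annihilating_poly r.
have [m [g + P_eq]] := multiplicity_XsubC P 1; rewrite P_neq0 /= => g1.
(* The exponent is m + 1 rather than m so that this factor vanishes at 1 even when m = 0; the Bezout
   identity then gives E the value 1 there. *)
have cop : coprimep (g * 'X) (('X - 1%:P) ^+ m.+1).
  apply: coprimep_expr; rewrite coprimep_XsubC.
  by rewrite rootM negb_or g1 rootE hornerX oner_neq0.
have /Bezout_eq1_coprimepP [[u v] /= uv] := cop.
pose E := u * (g * 'X).
have PE : E * E - E = - (u * v * 'X * ('X - 1%:P) * P).
  have E1 : E - 1 = - (v * ('X - 1%:P) ^+ m.+1) by rewrite -uv /E; ring.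
  have -> : E * E - E = E * (E - 1) by ring.
  by rewrite E1 P_eq /E exprS; ring.
pose f := horner_alg r E.
have Rf : f \in R.
  have powR k : r ^+ k.+1 \in R.
    elim: k => [|k IHk]; first by rewrite expr1.
    by rewrite exprS; apply: R_mul.
  have polR Q : horner_alg r (Q * 'X) \in R.
    elim/poly_ind: Q => [|Q c IHQ]; first by rewrite mul0r linear0 mem0v.
    rewrite mulrDl linearD memvD //.
      by rewrite rmorphM /= horner_algX R_mul.
    by rewrite rmorphM /= horner_algC horner_algX mulr_algl memvZ.
  by rewrite /f /E mulrA; apply: polR.
exists f; split=> //.
  apply/eqP; rewrite -[(f \o f)%VF]/(f * f) -subr_eq0 /f -rmorphM -rmorphB PE.
  by rewrite rmorphN rmorphM /= Pr mulr0 oppr0.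
rewrite horner_alg_fix //.
have := congr1 (horner^~ 1) uv; rewrite !hornerE subrr expr0n mulr0 addr0.
by move=> ->; rewrite scale1r.
Qed.

Section OperatorAction.

Variables (F : fieldType) (V : vectType F).
Implicit Types (R : {vspace 'End(V)}) (Z : {vspace V}).

(** The product space R Z; summing images over a basis of R keeps it a finite sum, and [actv_subP]
    is its basis-free description. *)
Definition actv R Z : {vspace V} := (\sum_(i < \dim R) (vbasis R)`_i @: Z)%VS.

Lemma actv_subP R Z (Y : {vspace V}) :
  reflect (forall r z, r \in R -> z \in Z -> r z \in Y) (actv R Z <= Y)%VS.
Proof.
apply: (iffP subv_sumP) => [sZY r z Rr Zz | sZY i _].
  rewrite (coord_vbasis Rr) sum_lfunE memv_suml // => i _.
  rewrite scale_lfunE memvZ //; have /subvP := sZY i isT; apply.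
  exact: memv_img.
apply/subvP=> _ /memv_imgP[z Zz ->]; rewrite sZY // vbasis_mem // mem_nth //.
by rewrite size_tuple.
Qed.

Lemma mem_actv R Z r z : r \in R -> z \in Z -> r z \in actv R Z.
Proof. by have /actv_subP := subvv (actv R Z); apply. Qed.

Lemma actvS R Z Y : (Z <= Y)%VS -> (actv R Z <= actv R Y)%VS.
Proof.
by move/subvP=> sZY; apply/actv_subP=> r z Rr /sZY Yz; apply: mem_actv.
Qed.

Lemma actvD R Z Y : actv R (Z + Y) = (actv R Z + actv R Y)%VS.
Proof. by rewrite /actv -big_split; apply: eq_bigr => r _; rewrite limgD. Qed.

Lemma actv0 R : actv R 0 = 0%VS.
Proof. by rewrite /actv big1 // => r _; rewrite limg0. Qed.

Lemma mem_actv_line R x y :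
  y \in actv R <[x]> -> exists2 r, r \in R & y = r x.
Proof.
case/memv_sumP=> [ys ys_in ->].
have /fin_all_exists[c cE] i : exists c, ys i = c *: (vbasis R)`_i x.
  have := ys_in i isT => /memv_imgP[_ /vlineP[c ->] ->].
  by exists c; rewrite linearZ.
exists (\sum_(i < \dim R) c i *: (vbasis R)`_i).
  apply: memv_suml => i _; rewrite memvZ // vbasis_mem // mem_nth //.
  by rewrite size_tuple.
by rewrite sum_lfunE; apply: eq_bigr => i _; rewrite scale_lfunE.
Qed.

Definition act_nil R Z := exists n, iter n (actv R) Z = 0%VS.

Lemma act_nilD R Z Y : act_nil R Z -> act_nil R Y -> act_nil R (Z + Y).
Proof.
have iter0 n : iter n (actv R) 0%VS = 0%VS.
  by elim: n => //= n ->; rewrite actv0.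
move=> [n Zn] [m Ym]; exists (n + m)%N.
have itD k : iter k (actv R) (Z + Y)%VS
             = (iter k (actv R) Z + iter k (actv R) Y)%VS.
  by elim: k => //= k ->; rewrite actvD.
by rewrite itD {1}addnC !iterD Zn Ym !iter0 addv0.
Qed.

(* Brauer's argument: a minimal nonzero Z with actv R Z = Z is of the form    *)
(* actv R <[x]> for some x in Z, whence r x = x for some r in R.              *)
Lemma act_nil_or_fixpoint R :
    (forall r s, r \in R -> s \in R -> (r \o s)%VF \in R) ->
  act_nil R fullv \/ exists r x, [/\ r \in R, x != 0 & r x = x].
Proof.
move=> R_mul; have: (actv R fullv <= fullv)%VS by apply: subvf.
have [n] := ubnP (\dim {:V}); elim: n (fullv : {vspace V}) => // n IHn Z.
rewrite ltnS => dimZ sRZ.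
have [RZ | RnZ] := eqVneq (actv R Z) Z; last first.
  have [||[k Zk]|] := IHn (actv R Z); [| exact: actvS | | by right].
    apply: leq_trans dimZ; rewrite ltn_neqAle (dimv_leqif_eq sRZ) RnZ.
    exact: dimvS.
  by left; exists k.+1; rewrite iterSr.
have [|not_fix] := boolp.pselect (exists r x, [/\ r \in R, x != 0 & r x = x]).
  by right.
(* Here R Z = Z. If R x = Z for some nonzero x in Z, then x = r x for some r in R. Otherwise each R
   x is a smaller R-stable space, nilpotent by induction, and R Z is a finite sum of such spaces. *)
left; have cycl x : x \in Z -> act_nil R (actv R <[x]>).
  move=> Zx; have sxZ : (actv R <[x]> <= Z)%VS.
    by rewrite -[X in (_ <= X)%VS]RZ actvS.
  have [-> | x_neq0] := eqVneq x 0; first by exists 0%N; rewrite /= actv0.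
  have [||//|//] := IHn (actv R <[x]>).
    apply: leq_trans dimZ.
    rewrite ltn_neqAle (dimv_leqif_eq sxZ) dimvS // andbT.
    apply/eqP=> xZ; case: not_fix.
    have [r Rr xr] : exists2 r, r \in R & x = r x.
      by apply: mem_actv_line; rewrite xZ.
    by exists r, x.
  apply/actv_subP=> r y Rr /mem_actv_line[s Rs ->].
  by rewrite -comp_lfunE mem_actv ?memv_line ?R_mul.
have [k Zk] : act_nil R (actv R Z).
  have -> : Z = (\sum_(x <- vbasis Z) <[x]>)%VS.
    by rewrite -span_def (span_basis (vbasisP Z)).
  have : {subset tval (vbasis Z) <= Z} by move=> x; apply: vbasis_mem.
  elim: (tval (vbasis Z)) => [|x s IHs] sZ.
    by exists 0%N; rewrite big_nil /= actv0.
  rewrite big_cons actvD; apply: act_nilD; first by apply/cycl/sZ/mem_head.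
  by apply: IHs => y sy; apply/sZ; rewrite in_cons sy orbT.
by exists k.+1; rewrite iterSr.
Qed.

End OperatorAction.

(** Start from e = 0 and enlarge. If R = (1 - e) W (1 - e) is not nilpotent, it contains an
    idempotent f fixing some nonzero x; f is orthogonal to e, so e + f is an idempotent of W whose
    image also contains x, and the rank grows. *)
Lemma maximal_idempotent (F : fieldType) (aT : falgType F)
    (W : {vspace 'End(aT)}) :
    (forall u v, u \in W -> v \in W -> (u \o v)%VF \in W) ->
  exists e : 'End(aT), exists R : {vspace 'End(aT)},
    [/\ e \in W, (e \o e)%VF = e, act_nil R fullv
      & forall w, w \in W -> ((\1 - e) \o w \o (\1 - e))%VF \in R].
Proof.
move=> W_mul.
have : ((0 : 'End(aT)) \o (0 : 'End(aT)))%VF = 0 by rewrite comp_lfun0l.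
have : (0 : 'End(aT)) \in W by apply: mem0v.
have : (\dim {:aT} - \dim (limg (0%R : 'End(aT))) < (\dim {:aT}).+1)%N.
  by rewrite ltnS leq_subr.
elim: (_.+1) (0 : 'End(aT)) => // n IHn e dim_e We ee.
pose c (w : 'End(aT)) := ((\1 - e) \o w \o (\1 - e))%VF.
have c_lin : linear c.
  move=> a u v; rewrite /c; move: (\1 - e)%VF => d.
  by rewrite comp_lfunDr comp_lfunDl -comp_lfunZr -comp_lfunZl.
pose cl : {linear 'End(aT) -> 'End(aT)} :=
  HB.pack c (GRing.isLinear.Build F 'End(aT) 'End(aT) *:%R c c_lin).
pose R := (linfun cl @: W)%VS.
have cR w : w \in W -> c w \in R.
  by move=> Ww; rewrite -[c w](lfunE cl) memv_img.
have e1 : (e \o (\1 - e) = 0)%VF.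
  by rewrite comp_lfunDr comp_lfunNr comp_lfun1r ee subrr.
have e2 : ((\1 - e) \o e = 0)%VF.
  by rewrite comp_lfunDl comp_lfunNl comp_lfun1l ee subrr.
have RP r : r \in R -> [/\ r \in W, (e \o r = 0)%VF & (r \o e = 0)%VF].
  (* W need not contain 1, yet the expansion w - e w - w e + e w e shows that R lies in W. *)
  case/memv_imgP=> w Ww ->; rewrite lfunE /= /c; split.
  - rewrite !(comp_lfunDl, comp_lfunDr, comp_lfunNl, comp_lfunNr,
      comp_lfun1l, comp_lfun1r).
    by rewrite !(memvD, memvN, W_mul).
  - by rewrite !comp_lfunA e1 !comp_lfun0l.
  - by rewrite -!comp_lfunA e2 !comp_lfun0r.
have R_mul r s : r \in R -> s \in R -> (r \o s)%VF \in R.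
  move=> Rr Rs; have [[Wr er re] [Ws es se]] := (RP _ Rr, RP _ Rs).
  suff -> : (r \o s)%VF = c (r \o s)%VF by apply/cR/W_mul.
  have r1 : ((\1 - e) \o r = r)%VF.
    by rewrite comp_lfunDl comp_lfunNl comp_lfun1l er subr0.
  have s1 : (s \o (\1 - e) = s)%VF.
    by rewrite comp_lfunDr comp_lfunNr comp_lfun1r se subr0.
  by rewrite /c comp_lfunA r1 -comp_lfunA s1.
have [nilR | [r [x [Rr x_neq0 rx]]]] := act_nil_or_fixpoint R_mul.
  by exists e, R; split.
have [f [Rf ff fx]] := idempotent_of_fixpoint R_mul Rr rx.
have [Wf ef fe] := RP _ Rf.
apply: (IHn (e + f)).
- have e_sub : (limg e <= limg (e + f)%R)%VS.
    apply/subvP=> _ /memv_imgP[v _ ->]; apply/memv_imgP; exists (e v).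
      exact: memvf.
    by rewrite add_lfunE -!comp_lfunE ee fe lfunE addr0.
  have ex : e x = 0 by rewrite -fx -comp_lfunE ef lfunE.
  have x_in : x \in limg (e + f)%R.
    by apply/memv_imgP; exists x; rewrite ?memvf // add_lfunE ex fx add0r.
  have x_out : x \notin limg e.
    apply: contra_neqN x_neq0 => /memv_imgP[v _ xv].
    by rewrite -ex xv -comp_lfunE ee.
  have dim_lt : (\dim (limg e) < \dim (limg (e + f)%R))%N.
    rewrite ltn_neqAle dimvS // andbT (dimv_leqif_sup e_sub).
    by apply/subvPn; exists x.
  have := dimvS (subvf (limg (e + f)%R)).
  by move: dim_e dim_lt; clear; lia.
- exact: memvD.
by rewrite comp_lfunDl !comp_lfunDr ee ef fe ff addr0 add0r.
Qed.

(** * Tensors and Sweedler sums *)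

Section LinearCombinators.

Variables (F : fieldType) (V : vectType F).

Lemma linear_fid : linear (fun x : V => x).
Proof. by []. Qed.

Lemma linear_lfun (W W' : vectType F) (f : 'Hom(W, W')) (g : V -> W) :
  linear g -> linear (fun x => f (g x)).
Proof. by move=> g_lin a u v; rewrite g_lin linearP. Qed.

Lemma linear_mull (A : falgType F) (a : A) (g : V -> A) :
  linear g -> linear (fun x => a * g x).
Proof. by move=> g_lin c u v; rewrite g_lin mulrDr -scalerAr. Qed.

Lemma linear_mulr (A : falgType F) (a : A) (g : V -> A) :
  linear g -> linear (fun x => g x * a).
Proof. by move=> g_lin c u v; rewrite g_lin mulrDl -scalerAl. Qed.

Lemma linear_scaler (U : lmodType F) (a : F) (g : V -> U) :
  linear g -> linear (fun x => a *: g x).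
Proof. by move=> g_lin c u v; rewrite g_lin scalerDr !scalerA mulrC. Qed.

Lemma linear_scalel (U : lmodType F) (w : U) (g : V -> F^o) :
  linear g -> linear (fun x => (g x : F) *: w).
Proof. by move=> g_lin c u v; rewrite g_lin scalerDl -scalerA. Qed.

Lemma linear_app (W W' : vectType F) (g : V -> 'Hom(W, W')) (w : W) :
  linear g -> linear (fun x => g x w).
Proof. by move=> g_lin a u v; rewrite g_lin add_lfunE scale_lfunE. Qed.

Lemma linear_purel (W W' : vectType F) (g : V -> W) (w : W') :
  linear g -> linear (fun x => g x \ox w).
Proof. by move=> g_lin a u v; rewrite g_lin pure_linearl. Qed.

Lemma linear_purer (W W' : vectType F) (g : V -> W') (w : W) :
  linear g -> linear (fun x => w \ox g x).
Proof. by move=> g_lin a u v; rewrite g_lin pure_linearr. Qed.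

Lemma linear_tlift (W W' : vectType F) (U : lmodType F)
    (phi : V -> W -> W' -> U) t :
  (forall a b, linear (fun x => phi x a b)) ->
  linear (fun x => tlift (phi x) t).
Proof.
move=> phi_lin c u v; rewrite /tlift scaler_sumr -big_split.
apply: eq_bigr => i _; rewrite scaler_sumr -big_split; apply: eq_bigr => j _.
by rewrite phi_lin scalerDr !scalerA mulrC.
Qed.

End LinearCombinators.

HB.instance Definition _ (F : fieldType) (V W : vectType F) (U : lmodType F)
    (phi : V -> W -> U) :=
  GRing.isLinear.Build F (tens V W) U *:%R (tlift phi) (tlift_linear phi).

Section TensorTheory.

Variables (F : fieldType) (V W : vectType F).
Implicit Types (A : {vspace V}) (B : {vspace W}).

Lemma eq_tlift (U : lmodType F) (phi psi : V -> W -> U) t :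
  phi =2 psi -> tlift phi t = tlift psi t.
Proof.
by move=> eq_phi; apply: eq_bigr => i _; apply: eq_bigr => j _; rewrite eq_phi.
Qed.

Lemma tlift_comp (U U' : lmodType F) (f : U -> U') (phi : V -> W -> U) t :
  linear f -> f (tlift phi t) = tlift (fun a b => f (phi a b)) t.
Proof.
move=> f_lin.
pose fl : {linear U -> U'} :=
  HB.pack f (GRing.isLinear.Build F U U' *:%R f f_lin).
rewrite -[f _]/(fl _) /tlift linear_sum; apply: eq_bigr => i _.
by rewrite linear_sum; apply: eq_bigr => j _; rewrite linearZ.
Qed.

Lemma tlift_exchange (V' W' : vectType F) (U : lmodType F)
    (phi : V -> W -> V' -> W' -> U) t t' :
  tlift (fun a b => tlift (fun c d => phi a b c d) t') t
  = tlift (fun c d => tlift (fun a b => phi a b c d) t) t'.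
Proof.
have tliftE (X X' : vectType F) psi (u : tens X X') : tlift psi u
    = \sum_(ij : 'I_(\dim {:X}) * 'I_(\dim {:X'}))
        u ij.1 ij.2 *: psi (refb ij.1) (refb ij.2) :> U.
  by rewrite /tlift pair_big.
rewrite !tliftE; under eq_bigr => ij _ do rewrite tliftE scaler_sumr.
under [RHS]eq_bigr => kl _ do rewrite tliftE scaler_sumr.
rewrite exchange_big; apply: eq_bigr => kl _; apply: eq_bigr => ij _.
by rewrite !scalerA mulrC.
Qed.

Lemma memv_tensv (A : {vspace V}) (B : {vspace W}) a b :
  a \in A -> b \in B -> a \ox b \in tensv A B.
Proof.
move=> Aa Bb; rewrite (coord_vbasis Aa) (coord_vbasis Bb).
have linl (w : W) : linear (fun v : V => v \ox w) := @pure_linearl F V W w.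
have linr (v : V) : linear (fun w : W => v \ox w) := @pure_linearr F V W v.
have suml n (c : 'I_n -> F) (vs : 'I_n -> V) (w : W) :
    (\sum_i c i *: vs i) \ox w = \sum_i c i *: (vs i \ox w).
  pose f : {linear V -> tens V W} :=
    HB.pack (fun v : V => v \ox w)
      (GRing.isLinear.Build F V (tens V W) *:%R _ (linl w)).
  by rewrite -[LHS]/(f _) linear_sum; apply: eq_bigr => i _; rewrite linearZ.
have sumr n (c : 'I_n -> F) (ws : 'I_n -> W) (v : V) :
    v \ox (\sum_i c i *: ws i) = \sum_i c i *: (v \ox ws i).
  pose f : {linear W -> tens V W} :=
    HB.pack (fun w : W => v \ox w)
      (GRing.isLinear.Build F W (tens V W) *:%R _ (linr v)).
  by rewrite -[LHS]/(f _) linear_sum; apply: eq_bigr => i _; rewrite linearZ.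
rewrite suml memv_suml // => i _; rewrite memvZ // sumr memv_suml // => j _.
by rewrite memvZ // memv_span // allpairs_f // mem_nth // size_tuple.
Qed.

Lemma lfun_tensv_sub (U : vectType F) (f : 'Hom(tens V W, U)) A B
    (X : {vspace U}) :
  (forall a b, a \in A -> b \in B -> f (a \ox b) \in X) ->
  forall t, t \in tensv A B -> f t \in X.
Proof.
move=> fX t Tt; rewrite memv_preim; move: t Tt; apply/subvP/span_subvP.
move=> _ /allpairsP[[a b] [Aa Bb ->]].
by rewrite -memv_preim fX ?vbasis_mem.
Qed.

Lemma tlift_mem (U : vectType F) (phi : V -> W -> U) A B (X : {vspace U}) t :
    (forall w, linear (phi^~ w)) -> (forall v, linear (phi v)) ->
    (forall a b, a \in A -> b \in B -> phi a b \in X) ->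
  t \in tensv A B -> tlift phi t \in X.
Proof.
move=> linl linr phiX Tt; rewrite -(lfunE (tlift phi)).
apply: lfun_tensv_sub Tt => a b Aa Bb.
by rewrite lfunE /= tlift_pure // phiX.
Qed.

Lemma eq_tlift_in (U : vectType F) (phi psi : V -> W -> U) A B t :
    (forall w, linear (phi^~ w)) -> (forall v, linear (phi v)) ->
    (forall w, linear (psi^~ w)) -> (forall v, linear (psi v)) ->
    (forall a b, a \in A -> b \in B -> phi a b = psi a b) ->
  t \in tensv A B -> tlift phi t = tlift psi t.
Proof.
move=> linl linr linl' linr' eq_phi Tt; apply/eqP.
rewrite -!(lfunE (tlift _)) -subr_eq0 -opp_lfunE -add_lfunE -memv0.
apply: lfun_tensv_sub Tt => a b Aa Bb.
by rewrite add_lfunE opp_lfunE !lfunE /= !tlift_pure // eq_phi // subrr mem0v.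
Qed.

Lemma tensvS (A A' : {vspace V}) (B B' : {vspace W}) :
  (A <= A')%VS -> (B <= B')%VS -> (tensv A B <= tensv A' B')%VS.
Proof.
move=> /subvP sA /subvP sB; apply/span_subvP=> _ /allpairsP[[a b] [Aa Bb ->]].
by rewrite memv_tensv ?sA ?sB ?vbasis_mem.
Qed.

Lemma tensv_sum (A : {vspace V}) (B : {vspace W}) t : t \in tensv A B ->
  exists2 s : seq (V * W), {in s, forall q, q.1 \in A /\ q.2 \in B}
    & t = \sum_(q <- s) q.1 \ox q.2.
Proof.
rewrite /tensv; set X := [seq _ | a <- _, b <- _].
have : {in X, forall u, exists a b, [/\ a \in A, b \in B & u = a \ox b]}.
  move=> _ /allpairsP[[a b] [Aa Bb ->]].
  by exists a, b; rewrite !(vbasis_mem Aa, vbasis_mem Bb).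
elim: X t => [|u X IHX] t XP.
  by rewrite span_nil memv0 => /eqP ->; exists [::]; rewrite // big_nil.
rewrite span_cons => /memv_addP[_ /vlineP[c ->] [t' Xt' ->]].
have [s sP ->] : exists2 s : seq (V * W),
    {in s, forall q, q.1 \in A /\ q.2 \in B} & t' = \sum_(q <- s) q.1 \ox q.2.
  by apply: IHX => // v Xv; apply: XP; rewrite in_cons Xv orbT.
have [a [b [Aa Bb ->]]] := XP u (mem_head _ _).
exists ((c *: a, b) :: s); last first.
  rewrite big_cons /=; congr (_ + _).
  by rewrite (GRing.scalable_linear (@pure_linearl F V W b)).
by move=> q; rewrite in_cons => /predU1P[->|/sP //]; rewrite memvZ.
Qed.

End TensorTheory.

Section Sweedler.

Variables (F : fieldType) (H : hopfAlgType F).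
Implicit Types (U : lmodType F) (D : {vspace H}).

Definition sw U (phi : H -> H -> U) (h : H) : U := tlift phi (comul h).

Lemma eq_sw U (phi psi : H -> H -> U) h : phi =2 psi -> sw phi h = sw psi h.
Proof. exact: eq_tlift. Qed.

Lemma sw_comp U U' (f : U -> U') (phi : H -> H -> U) h :
  linear f -> f (sw phi h) = sw (fun a b => f (phi a b)) h.
Proof. exact: tlift_comp. Qed.

Lemma sw_exchange U (phi : H -> H -> H -> H -> U) g h :
  sw (fun a b => sw (fun c d => phi a b c d) h) g
  = sw (fun c d => sw (fun a b => phi a b c d) g) h.
Proof. exact: tlift_exchange. Qed.

(** Coassociativity for Sweedler sums: apply to [comulA] the map that phi induces on (H (x) H) (x)
    H. *)
Lemma swA U (phi : H -> H -> H -> U) h :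
    (forall b c, linear (fun a => phi a b c)) ->
    (forall a c, linear (fun b => phi a b c)) ->
    (forall a b, linear (fun c => phi a b c)) ->
  sw (fun a c => sw (fun a1 a2 => phi a1 a2 c) a) h
  = sw (fun a b => sw (fun b1 b2 => phi a b1 b2) b) h.
Proof.
move=> lin1 lin2 lin3.
pose Phi := tlift (fun (t : tens H H) c => tlift (fun a b => phi a b c) t).
have PhiE t c : Phi (t \ox c) = tlift (fun a b => phi a b c) t.
  apply: tlift_pure => [w | v].
    exact: tlift_linear.
  by apply: linear_tlift => a b; apply: lin3.
have Phi_lin : linear Phi by apply: tlift_linear.
have := congr1 Phi (comulA h); rewrite !(tlift_comp _ _ Phi_lin).
rewrite /sw; under eq_tlift => a c do rewrite PhiE; move=> ->.
apply: eq_tlift => a b; rewrite (tlift_comp _ _ Phi_lin).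
by apply: eq_tlift => b1 b2; rewrite PhiE tlift_pure.
Qed.

Lemma swM U (phi : H -> H -> U) g h :
    (forall b, linear (phi^~ b)) -> (forall a, linear (phi a)) ->
  sw phi (g * h)
  = sw (fun a b => sw (fun c d => phi (a * c) (b * d)) h) g.
Proof.
move=> linl linr; rewrite /sw comulM.
rewrite (tlift_comp _ _ (tlift_linear phi)); apply: eq_tlift => a b.
rewrite (tlift_comp _ _ (tlift_linear phi)); apply: eq_tlift => c d.
by rewrite tlift_pure.
Qed.

Lemma sw_counitl U (f : H -> U) h : linear f ->
  sw (fun a b => (counit a : F) *: f b) h = f h.
Proof.
move=> f_lin; rewrite -[in RHS](counitl h) (tlift_comp _ _ f_lin).
by apply: eq_tlift => a b; rewrite (GRing.scalable_linear f_lin).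
Qed.

Lemma sw_counitr U (f : H -> U) h : linear f ->
  sw (fun a b => (counit b : F) *: f a) h = f h.
Proof.
move=> f_lin; rewrite -[in RHS](counitr h) (tlift_comp _ _ f_lin).
by apply: eq_tlift => a b; rewrite (GRing.scalable_linear f_lin).
Qed.

Lemma sw_antipodel U (f : H -> U) h : linear f ->
  sw (fun a b => f (antipode a * b)) h = (counit h : F) *: f 1.
Proof.
move=> f_lin; rewrite -[LHS](tlift_comp (fun a b => antipode a * b) _ f_lin).
by rewrite antipodel (GRing.scalable_linear f_lin).
Qed.

Lemma sw_antipoder U (f : H -> U) h : linear f ->
  sw (fun a b => f (a * antipode b)) h = (counit h : F) *: f 1.
Proof.
move=> f_lin; rewrite -[LHS](tlift_comp (fun a b => a * antipode b) _ f_lin).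
by rewrite antipoder (GRing.scalable_linear f_lin).
Qed.

Lemma comul_in D h : subcoalgebra D -> h \in D -> comul h \in tensv D D.
Proof. by move=> /subvP subD Dh; apply/subD/memv_img. Qed.

Lemma sw_mem (U : vectType F) (phi : H -> H -> U) D (X : {vspace U}) h :
    subcoalgebra D -> h \in D ->
    (forall b, linear (phi^~ b)) -> (forall a, linear (phi a)) ->
    (forall a b, a \in D -> b \in D -> phi a b \in X) ->
  sw phi h \in X.
Proof.
move=> subD Dh linl linr phiX.
exact: tlift_mem linl linr phiX (comul_in subD Dh).
Qed.

Lemma eq_sw_in (U : vectType F) (phi psi : H -> H -> U) D h :
    subcoalgebra D -> h \in D ->
    (forall b, linear (phi^~ b)) -> (forall a, linear (phi a)) ->
    (forall b, linear (psi^~ b)) -> (forall a, linear (psi a)) ->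
    (forall a b, a \in D -> b \in D -> phi a b = psi a b) ->
  sw phi h = sw psi h.
Proof.
move=> subD Dh linl linr linl' linr' eq_phi.
exact: eq_tlift_in linl linr linl' linr' eq_phi (comul_in subD Dh).
Qed.

Lemma linear_sw (V : vectType F) U (phi : V -> H -> H -> U) h :
  (forall a b, linear (fun x => phi x a b)) -> linear (fun x => sw (phi x) h).
Proof. exact: linear_tlift. Qed.

Lemma linear_swr (V : vectType F) U (phi : H -> H -> U) (g : V -> H) :
  linear g -> linear (fun x => sw phi (g x)).
Proof. by move=> g_lin c u v; rewrite /sw g_lin linearP tlift_linear. Qed.

End Sweedler.

Ltac lin :=
  intros;
  first [ exact: linear_fid
        | apply: linear_sw; lin
        | apply: linear_swr; lin
        | apply: linear_lfun; lin
        | apply: linear_mull; lin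
        | apply: linear_mulr; lin
        | apply: linear_scaler; lin
        | apply: linear_scalel; lin
        | apply: linear_purel; lin
        | apply: linear_purer; lin
        | apply: linear_app; lin ].

(** * Subcoalgebras and the projection onto K *)

Section Subcoalgebras.

Variables (F : fieldType) (H : hopfAlgType F).
Implicit Types C D : {vspace H}.

Lemma subcoalgebraD C D :
  subcoalgebra C -> subcoalgebra D -> subcoalgebra (C + D)%VS.
Proof.
rewrite /subcoalgebra limgD subv_add => subC subD; apply/andP; split.
  by apply: subv_trans subC _; apply: tensvS; apply: addvSl.
by apply: subv_trans subD _; apply: tensvS; apply: addvSr.
Qed.

(* The projection g onto C along a complement of C :&: D in D is the identity *)
(* on C and maps D into C :&: D; apply g (x) 1 and 1 (x) g to comul h.        *)
Lemma subcoalgebra_cap C D :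
  subcoalgebra C -> subcoalgebra D -> subcoalgebra (C :&: D)%VS.
Proof.
move=> subC subD; apply/subvP=> _ /memv_imgP[h /memv_capP[Ch Dh] ->].
pose g : 'End(H) := addv_pi2 D C.
have gC c : c \in C -> g c = c by apply: addv_pi2_id.
have gD d : d \in D -> g d \in (C :&: D)%VS.
  move=> Dd; rewrite memv_cap memv_pi2 /=.
  have -> : g d = d - addv_pi1 D C d.
    rewrite -{2}[d](@addv_pi1_pi2 _ _ D C) 1?addrAC ?subrr ?add0r //.
    by rewrite -[d]addr0 memv_add ?mem0v.
  by rewrite memvB ?memv_pi1.
have tid (t : tens H H) : tlift (fun a b => a \ox b) t = t.
  by rewrite [RHS]tens_sum.
have [Ct Dt] := (comul_in subC Ch, comul_in subD Dh).
have CDt : comul h \in tensv (C :&: D) D.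
  have <- : tlift (fun a b => g a \ox b) (comul h) = comul h.
    rewrite -[RHS]tid; apply: eq_tlift_in Ct; try by lin.
    by move=> a b Ca _; rewrite gC.
  apply: tlift_mem Dt; try by lin.
  by move=> a b Da Db; rewrite memv_tensv ?gD.
have <- : tlift (fun a b => a \ox g b) (comul h) = comul h.
  rewrite -[RHS]tid; apply: eq_tlift_in Ct; try by lin.
  by move=> a b _ Cb; rewrite gC.
apply: tlift_mem CDt; try by lin.
by move=> a b CDa Db; rewrite memv_tensv ?gD.
Qed.

(** As for semisimple modules: run through the simple subcoalgebras D, adding D to C' when it meets
    C + C' trivially. Otherwise D lies in C + C' by simplicity, the intersection being a
    subcoalgebra. *)
Lemma cosemisimple_compl C : cosemisimple H -> subcoalgebra C ->
  exists C', [/\ subcoalgebra C', (C :&: C' = 0)%VS & (C + C' = fullv)%VS].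
Proof.
move=> [Ds simpleDs sumDs] subC.
suff [C' [subC' CC' sub_sum]] : exists C',
    [/\ subcoalgebra C', (C :&: C' = 0)%VS & (\sum_(D <- Ds) D <= C + C')%VS].
  exists C'; split=> //; apply/eqP; rewrite eqEsubv subvf /=.
  by rewrite -[X in (X <= _)%VS]sumDs.
elim: Ds simpleDs {sumDs} => [|D Ds IHDs] simpleDs.
  exists 0%VS; split; rewrite ?capv0 ?big_nil ?sub0v //.
  by rewrite /subcoalgebra limg0 sub0v.
have [|C' [subC' CC' sub_sum]] := IHDs.
  by move=> E DsE; apply: simpleDs; rewrite in_cons DsE orbT.
have [subD D_neq0 simpleD] := simpleDs D (mem_head _ _).
have := simpleD _ (subcoalgebra_cap (subcoalgebraD subC subC') subD).
move=> /(_ (capvSr _ _)) [CC'D | CC'D]; last first.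
  exists C'; split=> //; rewrite big_cons subv_add sub_sum andbT.
  by rewrite -CC'D capvSl.
exists (C' + D)%VS; split; first exact: subcoalgebraD.
- apply/eqP; rewrite -subv0; apply/subvP=> c /memv_capP[Cc].
  case/memv_addP=> c' C'c' [d Dd c_eq].
  have d0 : d = 0.
    apply/eqP; rewrite -memv0 -CC'D memv_cap Dd andbT.
    have -> : d = c - c' by rewrite c_eq addrC addKr.
    by rewrite memv_add ?memvN.
  by rewrite -CC' memv_cap Cc c_eq d0 addr0.
by rewrite big_cons subv_add addvA addvSr (subv_trans sub_sum) ?addvSl.
Qed.

End Subcoalgebras.

Section Retraction.

Variables (F : fieldType) (H : hopfAlgType F) (K : usubalg H).

(* p is counit on K and vanishes on a complementary subcoalgebra. *)
Lemma hopf_subalgebra_functional :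
    cosemisimple H -> hopf_subalgebra K ->
  exists p : 'Hom(H, F^o),
    [/\ p 1 = 1,
        forall h, sw (fun a b => (p b : F) *: a) h \in K,
        forall h, sw (fun a b => (p a : F) *: b) h
                  = sw (fun a b => (p b : F) *: a) h
      & forall h k, k \in K -> p (h * k) = (counit k : F) *: p h].
Proof.
move=> ssH [subK antiK].
have [K' [subK' KK' KK'1]] := cosemisimple_compl ssH subK.
pose pi : 'End(H) := daddv_pi K K'.
pose p : 'Hom(H, F^o) := (counit \o pi)%VF.
have piK k : k \in K -> pi k = k by apply: daddv_pi_id.
have piK' k : k \in K' -> pi k = 0.
  move=> K'k; have := daddv_pi_add KK' (_ : k \in K + K')%VS.
  rewrite KK'1 memvf => /(_ isT) /eqP.
  rewrite (daddv_pi_id _ K'k) 1?capvC // addrC -subr_eq0 addrAC subrr add0r.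
  by move/eqP.
have pK k : k \in K -> p k = counit k by move=> Kk; rewrite comp_lfunE piK.
have pK' k : k \in K' -> p k = 0.
  by move=> Kk; rewrite comp_lfunE piK' // linear0.
have dec h : exists2 k, k \in K & exists2 k', k' \in K' & h = k + k'.
  have := memvf h; rewrite -KK'1 => /memv_addP[k Kk [k' K'k' ->]].
  by exists k => //; exists k'.
have lin_ext (U : vectType F) (f g : H -> U) : linear f -> linear g ->
    {in K, f =1 g} -> {in K', f =1 g} -> f =1 g.
  move=> f_lin g_lin fK fK' h; have [k Kk [k' Kk' ->]] := dec h.
  by rewrite -[k]scale1r f_lin g_lin fK ?fK'.
(* Both Sweedler formulas for pi are checked on the two summands: on K, p is the counit; on K', p
   vanishes and K' is a subcoalgebra. *)
have pil h : sw (fun a b => (p a : F) *: b) h = pi h.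
  move: h; apply: lin_ext; [lin | lin | move=> k Kk | move=> k Kk].
    rewrite piK // -[RHS](counitl k); apply: (eq_sw_in subK Kk); try by lin.
    by move=> a b Ka _; rewrite pK.
  rewrite piK' //; apply/eqP; rewrite -memv0.
  apply: (sw_mem subK' Kk); try by lin.
  by move=> a b K'a _; rewrite pK' // scale0r mem0v.
have pir h : sw (fun a b => (p b : F) *: a) h = pi h.
  move: h; apply: lin_ext; [lin | lin | move=> k Kk | move=> k Kk].
    rewrite piK // -[RHS](counitr k); apply: (eq_sw_in subK Kk); try by lin.
    by move=> a b _ Kb; rewrite pK.
  rewrite piK' //; apply/eqP; rewrite -memv0.
  apply: (sw_mem subK' Kk); try by lin.
  by move=> a b _ K'b; rewrite pK' // scale0r mem0v.
have KM a b : a \in K -> b \in K -> a * b \in K.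
  by move=> Ka Kb; rewrite memvM.
exists p; split.
- by rewrite pK ?usubalg1 // counit1.
- by move=> h; rewrite pir memv_pi.
- by move=> h; rewrite pir pil.
move=> h k Kk; move: h; apply: lin_ext;
  [lin | lin | move=> h Kh | move=> h K'h].
  by rewrite !pK ?KM // counitM mulrC.
rewrite (pK' h) // scaler0.
(* For h in K', w = p (h_(1) k) h_(2) lies in K' because h_(2) does. Inserting k_(2) S k_(3)
   rewrites w as pi (h k_(1)) S k_(2), which lies in K. So w = 0, and its counit is p (h k). *)
pose w := sw (fun a b => (p (a * k) : F) *: b) h.
have w0 : w = 0.
  apply/eqP; rewrite -memv0 -KK' memv_cap; apply/andP; split; last first.
    apply: (sw_mem subK' K'h); try by lin.
    by move=> a b _ K'b; rewrite memvZ.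
  suff -> : w = sw (fun c d => pi (h * c) * antipode d) k.
    apply: (sw_mem subK Kk); try by lin.
    move=> c d Kc Kd; rewrite KM ?memv_pi //.
    by have /subvP := antiK; apply; rewrite memv_img.
  transitivity (sw (fun a b => sw (fun c d => sw (fun c1 c2 =>
      (p (a * c1) : F) *: (b * (c2 * antipode d))) c) k) h).
    apply: eq_sw => a b; rewrite (swA (phi := fun c1 c2 d =>
      (p (a * c1) : F) *: (b * (c2 * antipode d)))); try by lin.
    transitivity (sw (fun c t => (counit t : F) *: ((p (a * c) : F) *: b)) k).
      by rewrite (sw_counitr (f := fun c => (p (a * c) : F) *: b)) //; lin.
    apply: eq_sw => c t.
    rewrite (sw_antipoder (f := fun x => (p (a * c) : F) *: (b * x))).
      by rewrite mulr1.
    by lin.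
  rewrite (sw_exchange (fun a b c d => sw (fun c1 c2 =>
      (p (a * c1) : F) *: (b * (c2 * antipode d))) c)).
  apply: eq_sw => c d; rewrite -pil swM; try by lin.
  rewrite (sw_comp (f := fun x => x * antipode d)); last by lin.
  apply: eq_sw => a b.
  rewrite (sw_comp (f := fun x => x * antipode d)); last by lin.
  by apply: eq_sw => c1 c2; rewrite -scalerAl mulrA.
have := congr1 counit w0; rewrite linear0 /w => <-.
rewrite (sw_comp (f := counit)); last by lin.
rewrite -[LHS](sw_counitr (f := fun a => p (a * k))); last by lin.
by apply: eq_sw => a b; rewrite linearZ /= [RHS]mulrC.
Qed.

End Retraction.

(** * Translates of p *)

Section Translates.

Variables (F : fieldType) (H : hopfAlgType F) (p : 'Hom(H, F^o)).

(* tau y h = h_(1) p (y h_(2)): convolution with the translate p (y _). *)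
Definition tau_fun (y h : H) : H := sw (fun a b => (p (y * b) : F) *: a) h.

Lemma tau_fun_linearl h : linear (tau_fun^~ h).
Proof. by rewrite /tau_fun; lin. Qed.

Lemma tau_fun_linearr y : linear (tau_fun y).
Proof. by rewrite /tau_fun; lin. Qed.

HB.instance Definition _ y :=
  GRing.isLinear.Build F H H *:%R (tau_fun y) (tau_fun_linearr y).

Definition tau_lfun (y : H) : 'End(H) := linfun (tau_fun y).

Lemma tau_lfun_linear : linear tau_lfun.
Proof.
move=> c y z; apply/lfunP=> h; rewrite add_lfunE scale_lfunE !lfunE.
exact: tau_fun_linearl.
Qed.

HB.instance Definition _ :=
  GRing.isLinear.Build F H 'End(H) *:%R tau_lfun tau_lfun_linear.

Definition tau : 'Hom(H, 'End(H)) := linfun tau_lfun.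

Lemma tauE y h : tau y h = sw (fun a b => (p (y * b) : F) *: a) h.
Proof. by rewrite /tau lfunE /= /tau_lfun lfunE. Qed.

Lemma tau_mul y x h :
  tau y (x * h) = sw (fun x1 x2 => x1 * tau (y * x2) h) x.
Proof.
rewrite tauE swM; try by lin.
apply: eq_sw => x1 x2; rewrite tauE.
rewrite (sw_comp (f := fun z => x1 * z)); last by lin.
by apply: eq_sw => a b; rewrite -scalerAr mulrA.
Qed.

Lemma counit_tau y h : counit (tau y h) = p (y * h).
Proof.
rewrite tauE (sw_comp (f := counit)); last by lin.
rewrite -[RHS](sw_counitl (f := fun b => p (y * b))); last by lin.
by apply: eq_sw => a b; rewrite linearZ /= [LHS]mulrC.
Qed.

Variable K : usubalg H.
Hypothesis p1 : p 1 = 1.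
Hypothesis p_memr : forall h, sw (fun a b => (p b : F) *: a) h \in K.
Hypothesis p_comm : forall h,
  sw (fun a b => (p a : F) *: b) h = sw (fun a b => (p b : F) *: a) h.
Hypothesis pM : forall h k, k \in K -> p (h * k) = (counit k : F) *: p h.

Lemma tau1E h : tau 1 h = sw (fun a b => (p b : F) *: a) h.
Proof. by rewrite tauE; apply: eq_sw => a b; rewrite mul1r. Qed.

Lemma tau1_mem h : tau 1 h \in K.
Proof. by rewrite tau1E. Qed.

Lemma counit_tau1 h : counit (tau 1 h) = p h.
Proof. by rewrite counit_tau mul1r. Qed.

Lemma p_mul_tau1 y h : p (y * tau 1 h) = (p h : F) *: p y.
Proof. by rewrite pM ?tau1_mem // counit_tau1. Qed.

(** Compute p (y pi h), with pi = [tau 1], in two ways: as pi h lies in K it is p y times p h, and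
    with pi h = p h_(1) h_(2) it is p h_(1) p (y h_(2)). *)
Lemma p_tau y h : p (tau y h) = (p h : F) *: p y.
Proof.
rewrite -p_mul_tau1 tau1E -p_comm tauE (sw_comp (f := p)); last by lin.
rewrite (sw_comp (f := fun z => p (y * z))); last by lin.
by apply: eq_sw => a b; rewrite -scalerAr !linearZ /= [LHS]mulrC.
Qed.

(** Insert S y'_(1) y'_(2) before [tau y'_(3) t]; by [tau_mul] the last two factors merge into pi
    (y'_(2) t), an element of K, which p splits off. *)
Lemma p_mul_tau y y' t :
  p (y * tau y' t) = sw (fun a b => (p (y * antipode a) : F) *: p (b * t)) y'.
Proof.
transitivity (sw (fun c b => sw (fun a1 a2 =>
    p (y * (antipode a1 * a2) * tau b t)) c) y').
  rewrite -[LHS](sw_counitl (f := fun b => p (y * tau b t))); last by lin.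
  apply: eq_sw => c b.
  rewrite (sw_antipodel (f := fun z => p (y * z * tau b t))); last by lin.
  by rewrite mulr1.
rewrite (swA (phi := fun a1 a2 b => p (y * (antipode a1 * a2) * tau b t)));
  try by lin.
apply: eq_sw => a b.
transitivity (p (y * antipode a * tau 1 (b * t))); last first.
  by rewrite p_mul_tau1 [LHS]mulrC.
rewrite tau_mul (sw_comp (f := fun z => p (y * antipode a * z))); last by lin.
by apply: eq_sw => b1 b2; rewrite mul1r !mulrA.
Qed.

(** The composite is h_(1) p (y [tau y' h_(2)]), and [p_mul_tau] makes the scalar a translate of p
    again. The translating element involves y' only through y'_(2), so it stays in any subcoalgebra
    containing y'. *)
Lemma tau_tau y y' h :
  tau y (tau y' h)
  = tau (sw (fun a b => (p (y * antipode a) : F) *: b) y') h.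
Proof.
rewrite [tau y' h]tauE (sw_comp (f := tau y)); last by lin.
transitivity (sw (fun a c => sw (fun a1 a2 =>
    (p (y' * c) : F) *: ((p (y * a2) : F) *: a1)) a) h).
  apply: eq_sw => a b; rewrite linearZ /= tauE.
  by rewrite (sw_comp (f := fun z => (p (y' * b) : F) *: z)); last by lin.
rewrite (swA (phi := fun a1 a2 c =>
    (p (y' * c) : F) *: ((p (y * a2) : F) *: a1))); try by lin.
rewrite tauE; apply: eq_sw => a t.
transitivity ((p (y * tau y' t) : F) *: a); last first.
  suff -> : p (y * tau y' t)
      = p (sw (fun a b => (p (y * antipode a) : F) *: b) y' * t) by [].
  rewrite p_mul_tau (sw_comp (f := fun z => p (z * t))); last by lin.
  by apply: eq_sw => c d; rewrite -scalerAl linearZ.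
rewrite tauE (sw_comp (f := fun z => (p (y * z) : F) *: a)); last by lin.
apply: eq_sw => c d; rewrite scalerA -scalerAr.
suff -> : p ((p (y' * d) : F) *: (y * c)) = (p (y' * d) : F) *: p (y * c).
  by [].
by rewrite linearZ.
Qed.

Lemma tau1_mulr h k : subcoalgebra (K : {vspace H}) -> k \in K ->
  tau 1 (h * k) = tau 1 h * k.
Proof.
move=> subK Kk; rewrite !tau1E swM; try by lin.
rewrite (sw_comp (f := fun z => z * k)); last by lin.
apply: eq_sw => a b.
rewrite -[RHS](sw_counitr (f := fun c => ((p b : F) *: a) * c)); last by lin.
apply: (eq_sw_in subK Kk); try by lin.
by move=> c d _ Kd; rewrite pM // -scalerAl scalerA.
Qed.

Lemma tau_mem (D : {vspace H}) y h :
  subcoalgebra D -> h \in D -> tau y h \in D.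
Proof.
move=> subD Dh; rewrite tauE; apply: (sw_mem subD Dh); try by lin.
by move=> a b Da _; rewrite memvZ.
Qed.

Lemma tau_img_comp (L : {vspace H}) u v : subcoalgebra L ->
  u \in (tau @: L)%VS -> v \in (tau @: L)%VS -> (u \o v)%VF \in (tau @: L)%VS.
Proof.
move=> subL /memv_imgP[y Ly ->] /memv_imgP[y' Ly' ->].
apply/memv_imgP; exists (sw (fun a b => (p (y * antipode a) : F) *: b) y').
  apply: (sw_mem subL Ly'); try by lin.
  by move=> a b _ Lb; rewrite memvZ.
by apply/lfunP=> h; rewrite comp_lfunE tau_tau.
Qed.

(** By [p_tau], p e = p y p, so idempotency leaves p y = 0 or 1. If p y = 0, then r = (1 - e) pi (1
    - e) satisfies p r = p, so p takes the value 1 on all iterates of r at 1, contradicting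
    nilpotency of R. *)
Lemma p_idempotent (e : 'End(H)) (y : H) (R : {vspace 'End(H)}) :
    e = tau y -> (e \o e)%VF = e -> act_nil R fullv ->
    ((\1 - e) \o tau 1 \o (\1 - e))%VF \in R ->
  p y = 1.
Proof.
move=> e_eq ee [n nilR] Rr.
have pe h : p (e h) = (p h : F) *: p y by rewrite e_eq p_tau.
have : (p y : F) * p y = p y.
  have ee1 : e (e 1) = e 1 by rewrite -comp_lfunE ee.
  by have := pe (e 1); rewrite ee1 pe p1 scale1r => /esym.
have [py0 _ | py_neq0 py2] := eqVneq (p y) 0; last first.
  by apply: (mulfI py_neq0); rewrite py2 mulr1.
set r := (_ \o _)%VF in Rr.
have pr h : p (r h) = p h.
  have pe1 z : p ((\1 - e)%VF z) = p z.
    by rewrite add_lfunE opp_lfunE id_lfunE linearB /= pe py0 scaler0 subr0.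
  by rewrite !comp_lfunE pe1 p_tau pe1 p1 [_ *: 1]mulr1.
suff [z zn pz] : exists2 z, z \in iter n (actv R) fullv & p z = 1.
  move: zn pz; rewrite nilR memv0 => /eqP->; rewrite linear0 => /esym/eqP.
  by rewrite oner_eq0.
elim: n {nilR} => [|n [z zn pz]]; first by exists 1; rewrite ?memvf.
by exists (r z); [apply: mem_actv | rewrite pr].
Qed.

End Translates.

Lemma tens_lfunP (F : fieldType) (V W U : vectType F)
    (f g : 'Hom(tens V W, U)) :
  (forall v w, f (v \ox w) = g (v \ox w)) -> f = g.
Proof.
move=> eq_fg; apply/lfunP=> t; rewrite (tens_sum t) !linear_sum.
apply: eq_bigr => i _; rewrite !linear_sum; apply: eq_bigr => j _.
by rewrite !linearZ /= eq_fg.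
Qed.

(** * Two conjugate idempotents on H (x) H *)

Section TwistedIdempotent.

Variables (F : fieldType) (H : hopfAlgType F) (p : 'Hom(H, F^o)) (y0 : H).

Let e : 'End(H) := tau p y0.

Definition twisted : 'End(tens H H) :=
  linfun (tlift (fun x h => sw (fun x1 x2 => x1 \ox tau p (y0 * x2) h) x)).

Definition untwisted : 'End(tens H H) := linfun (tlift (fun x h => x \ox e h)).

Definition galois_map : 'End(tens H H) :=
  linfun (tlift (fun x h => sw (fun x1 x2 => x1 \ox (x2 * h)) x)).

Definition galois_inv : 'End(tens H H) :=
  linfun (tlift (fun x h => sw (fun x1 x2 => x1 \ox (antipode x2 * h)) x)).

Lemma twistedE x h :
  twisted (x \ox h) = sw (fun x1 x2 => x1 \ox tau p (y0 * x2) h) x.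
Proof. by rewrite lfunE /= tlift_pure //; lin. Qed.

Lemma untwistedE x h : untwisted (x \ox h) = x \ox e h.
Proof. by rewrite lfunE /= tlift_pure //; lin. Qed.

Lemma galois_mapE x h :
  galois_map (x \ox h) = sw (fun x1 x2 => x1 \ox (x2 * h)) x.
Proof. by rewrite lfunE /= tlift_pure //; lin. Qed.

Lemma galois_invE x h :
  galois_inv (x \ox h) = sw (fun x1 x2 => x1 \ox (antipode x2 * h)) x.
Proof. by rewrite lfunE /= tlift_pure //; lin. Qed.

Lemma galois_mapK : (galois_inv \o galois_map = \1)%VF.
Proof.
apply: tens_lfunP => x h; rewrite comp_lfunE galois_mapE id_lfunE.
rewrite (sw_comp (f := galois_inv)); last by lin.
transitivity (sw (fun x1 x2 => sw (fun a b =>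
    a \ox (antipode b * x2 * h)) x1) x).
  apply: eq_sw => x1 x2; rewrite galois_invE.
  by apply: eq_sw => a b; rewrite mulrA.
rewrite (swA (phi := fun a b c => a \ox (antipode b * c * h))); try by lin.
rewrite -[RHS](sw_counitr (f := fun a => a \ox h)); last by lin.
apply: eq_sw => a t.
rewrite (sw_antipodel (f := fun z => a \ox (z * h))); last by lin.
by rewrite mul1r.
Qed.

(** This is [tau_mul] inside the second tensor factor: x_(2) [tau (y0 x_(3)) h] =
    [tau y0 (x_(2) h)]. *)
Lemma galois_map_twisted :
  (galois_map \o twisted = untwisted \o galois_map)%VF.
Proof.
apply: tens_lfunP => x h; rewrite !comp_lfunE twistedE galois_mapE.
rewrite (sw_comp (f := galois_map)); last by lin.
rewrite (sw_comp (f := untwisted)); last by lin.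
transitivity (sw (fun x1 x2 => sw (fun a b =>
    a \ox (b * tau p (y0 * x2) h)) x1) x).
  by apply: eq_sw => x1 x2; rewrite galois_mapE.
rewrite (swA (phi := fun a b c => a \ox (b * tau p (y0 * c) h))); try by lin.
apply: eq_sw => a t; rewrite untwistedE /e tau_mul.
by rewrite (sw_comp (f := fun z => a \ox z)); last by lin.
Qed.

Hypothesis ee : (e \o e)%VF = e.

Lemma untwisted_idem : (untwisted \o untwisted = untwisted)%VF.
Proof.
apply: tens_lfunP => x h; rewrite comp_lfunE !untwistedE.
by rewrite -comp_lfunE ee.
Qed.

Lemma galois_map_inj : lker galois_map == 0%VS.
Proof.
apply/lker0P; apply: (can_inj (g := galois_inv)) => t.
by rewrite -comp_lfunE galois_mapK id_lfunE.
Qed.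

Lemma twisted_idem : (twisted \o twisted = twisted)%VF.
Proof.
rewrite -[LHS](lker0_compKf galois_map_inj) -[RHS](lker0_compKf galois_map_inj).
congr (_ \o _)%VF; rewrite comp_lfunA galois_map_twisted -comp_lfunA.
by rewrite galois_map_twisted comp_lfunA untwisted_idem.
Qed.

End TwistedIdempotent.

(** * A translate of p that is the counit on L *)

Section CounitTranslate.

Variables (F : fieldType) (H : hopfAlgType F) (p : 'Hom(H, F^o)).
Variables (K L : usubalg H).
Hypothesis p1 : p 1 = 1.
Hypothesis p_memr : forall h, sw (fun a b => (p b : F) *: a) h \in K.
Hypothesis p_comm : forall h,
  sw (fun a b => (p a : F) *: b) h = sw (fun a b => (p b : F) *: a) h.
Hypothesis pM : forall h k, k \in K -> p (h * k) = (counit k : F) *: p h.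

Lemma translate_eq_counit : subcoalgebra (L : {vspace H}) ->
  exists2 y, y \in L & {in L, forall x, p (y * x) = counit x}.
Proof.
move=> subL.
have [e [R [/memv_imgP[y Ly e_eq] ee nilR WR]]] :=
  maximal_idempotent (fun u v => @tau_img_comp F H p K p_memr pM L u v subL).
have WR' x : x \in L -> ((\1 - e) \o tau p (y * x) \o (\1 - e))%VF \in R.
  by move=> Lx; apply/WR/memv_img; rewrite memvM.
have py : p y = 1.
  apply: (p_idempotent p1 p_memr p_comm pM e_eq ee nilR).
  by apply/WR/memv_img; rewrite usubalg1.
subst e.
pose E := twisted p y; pose E0 := untwisted p y; pose G := galois_map H.
pose T : {vspace tens H H} := tensv L fullv.
have TE : (E @: T <= T)%VS.
  apply/subvP=> _ /memv_imgP[t Tt ->]; apply: lfun_tensv_sub Tt => x h Lx _.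
  rewrite twistedE; apply: (sw_mem subL Lx); try by lin.
  by move=> x1 x2 Lx1 _; rewrite memv_tensv ?memvf.
have TG : (G @: T <= T)%VS.
  apply/subvP=> _ /memv_imgP[t Tt ->]; apply: lfun_tensv_sub Tt => x h Lx _.
  rewrite galois_mapE; apply: (sw_mem subL Lx); try by lin.
  by move=> x1 x2 Lx1 _; rewrite memv_tensv ?memvf.
have kerG := galois_map_inj H.
have dimG (X : {vspace tens H H}) : \dim (G @: X) = \dim X.
  by apply: limg_dim_eq; rewrite (eqP kerG) capv0.
have GT : (G @: T = T)%VS by apply/eqP; rewrite eqEdim TG dimG leqnn.
(* G maps T onto itself injectively and carries E to E0, so E0 T = G E T. *)
have dimEE0 : \dim (E0 @: T) = \dim (E @: T).
  by rewrite -{1}GT -limg_comp -galois_map_twisted limg_comp dimG.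
(* If E v = v and E0 v = 0, then v = Q E Q v with Q = 1 (x) (1 - e). The map Q E Q sends L (x) Z
   into L (x) R Z, so v lies in L (x) R^n H for every n, which is eventually 0. *)
have E_ker : (E @: T :&: lker E0 = 0)%VS.
  apply/eqP; rewrite -subv0; apply/subvP=> v /memv_capP[ETv].
  rewrite memv_ker => /eqP E0v.
  have Ev : E v = v.
    have /memv_imgP[t _ ->] := ETv.
    by rewrite -comp_lfunE twisted_idem.
  pose Q : 'End(tens H H) :=
    linfun (tlift (fun x h => x \ox (\1 - tau p y)%VF h)).
  have QE x h : Q (x \ox h) = x \ox (\1 - tau p y)%VF h.
    by rewrite lfunE /= tlift_pure //; lin.
  have Qv : Q v = v.
    have -> : Q = (\1 - E0)%VF.
      apply: tens_lfunP => x h; rewrite QE [RHS]add_lfunE opp_lfunE id_lfunE.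
      rewrite untwistedE add_lfunE opp_lfunE id_lfunE addrC -scaleN1r.
      by rewrite pure_linearr scaleN1r addrC.
    by rewrite add_lfunE opp_lfunE id_lfunE E0v subr0.
  have vZ Z : v \in tensv L Z -> v \in tensv L (actv R Z).
    move=> Zv; have <- : (Q \o E \o Q)%VF v = v.
      by rewrite !comp_lfunE Qv Ev Qv.
    apply: lfun_tensv_sub Zv => x z Lx Zz.
    rewrite !comp_lfunE QE twistedE (sw_comp (f := Q)); last by lin.
    apply: (sw_mem subL Lx); try by lin.
    move=> x1 x2 Lx1 Lx2; rewrite QE -!comp_lfunE memv_tensv //.
    by rewrite mem_actv ?WR'.
  have [n Rn] := nilR.
  have : v \in tensv L (iter n (actv R) fullv).
    elim: n {Rn} => [|n IHn]; last exact: vZ.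
    by have /subvP := TE; apply.
  rewrite Rn => /(lfun_tensv_sub (f := \1%VF)); rewrite id_lfunE; apply.
  move=> a b _; rewrite memv0 id_lfunE => /eqP ->.
  have := GRing.scalable_linear (@pure_linearr F H H a) 0 0.
  by rewrite !scale0r => ->; rewrite /= scale0r mem0v.
have E0E : (E0 @: (E @: T) = E0 @: T)%VS.
  by apply/eqP; rewrite eqEdim limgS //= (limg_dim_eq E_ker) dimEE0.
(* Th intertwines E with e, and absorbs E0 because p e = p. Writing E0 (x (x) 1) as E0 (E u) and
   applying Th gives x = e (Th u), hence e x = x. *)
pose Th : 'Hom(tens H H, H) := linfun (tlift (fun x h => (p h : F) *: x)).
have ThE x h : Th (x \ox h) = (p h : F) *: x.
  by rewrite lfunE /= tlift_pure //; lin.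
have ThE0 : (Th \o E0 = Th)%VF.
  apply: tens_lfunP => x h; rewrite comp_lfunE untwistedE !ThE.
  by rewrite (p_tau p_memr p_comm pM) py [_ *: 1]mulr1.
have Th_E : (Th \o E = tau p y \o Th)%VF.
  apply: tens_lfunP => x h; rewrite !comp_lfunE twistedE ThE.
  rewrite (sw_comp (f := Th)); last by lin.
  rewrite linearZ /= tauE (sw_comp (f := fun z => (p h : F) *: z)); last by lin.
  apply: eq_sw => x1 x2; rewrite ThE (p_tau p_memr p_comm pM).
  by rewrite scalerA.
exists y => // x Lx.
have /memv_imgP[_ /memv_imgP[u _ ->] xu] : E0 (x \ox 1) \in (E0 @: (E @: T))%VS.
  by rewrite E0E memv_img ?memv_tensv ?memvf.
have x_eq : x = tau p y (Th u).
  rewrite -comp_lfunE -Th_E comp_lfunE -ThE0 comp_lfunE -xu -comp_lfunE ThE0.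
  by rewrite ThE p1 scale1r.
by rewrite -counit_tau x_eq -comp_lfunE ee.
Qed.

(** The pairs are (S y_(1), y_(2)): S y_(1) pi (y_(2) l) = S y_(1) y_(2) [tau y_(3) l] = [tau y l],
    which is l since p (y _) is the counit on L. *)
Lemma retraction_dual_basis : subcoalgebra (L : {vspace H}) ->
    (antipode @: L <= L)%VS ->
  exists2 s : seq (H * H), {in s, forall q, q.1 \in L /\ q.2 \in L}
    & {in L, forall l, \sum_(q <- s) q.1 * tau p 1 (q.2 * l) = l}.
Proof.
move=> subL /subvP antiL; have [y Ly yP] := translate_eq_counit subL.
have [s sL s_eq] := tensv_sum (comul_in subL Ly).
exists [seq (antipode q.1, q.2) | q <- s] => [_ /mapP[q /sL[Lq1 Lq2] ->]|l Ll].
  by split=> //; apply/antiL/memv_img.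
rewrite big_map /=.
transitivity (sw (fun a b => antipode a * tau p 1 (b * l)) y).
  rewrite /sw s_eq linear_sum; apply: eq_bigr => q _.
  by rewrite /= tlift_pure //; lin.
transitivity (sw (fun a b => sw (fun b1 b2 =>
    antipode a * b1 * tau p b2 l) b) y).
  apply: eq_sw => a b; rewrite tau_mul.
  rewrite (sw_comp (f := fun z => antipode a * z)); last by lin.
  by apply: eq_sw => b1 b2; rewrite mulrA mul1r.
rewrite -(swA (phi := fun a b c => antipode a * b * tau p c l)); try by lin.
transitivity (sw (fun a b => (counit a : F) *: tau p b l) y).
  apply: eq_sw => a b.
  rewrite (sw_antipodel (f := fun z => z * tau p b l)); last by lin.
  by rewrite mul1r.
rewrite (sw_counitl (f := fun b => tau p b l)); last by lin.
rewrite tauE -[RHS](sw_counitr (f := fun z => z)) //.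
apply: (eq_sw_in subL Ll); try by lin.
by move=> a b _ Lb; rewrite yP.
Qed.

End CounitTranslate.

(** * The isomorphism *)

Lemma indt_suml (A B : nzRingType) (f : {rmorphism B -> A}) (M : lmodType B)
    (I : Type) (s : seq I) (a : I -> A) (m : M) :
  indt f (\sum_(i <- s) a i) m = \sum_(i <- s) indt f (a i) m.
Proof.
apply: (big_morph (fun x => indt f x m)) => [x y|]; first exact: indtDl.
by apply/ind_classP/ind_zero.
Qed.

(** The inverse g of the natural map h sends x (x) m to the sum of q.1 (x) pi (q.2 x) m. In g h the
    factor pi (q.2 l) lies in L and K, in h g the factor pi (q.2 x) lies in K; each can therefore
    cross the tensor sign and be reabsorbed by the dual basis formula. *)
Lemma mackey_of_dual_basis (F : fieldType) (aT : falgType F) (K L : usubalg aT)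
    (eqKL : (K * L = L * K)%VS) (pi : 'End(aT)) (s : seq (aT * aT))
    (M : lmodType (subvs_of K)) :
    (forall h, pi h \in K) ->
    (forall h k, k \in K -> pi (h * k) = pi h * k) ->
    (forall l, l \in L -> pi l \in L) ->
    {in s, forall q, q.1 \in L /\ q.2 \in L} ->
    {in L, forall l, \sum_(q <- s) q.1 * pi (q.2 * l) = l} ->
  exists f : {linear resm (incl (uprod_subl eqKL))
                       (indm (incl (uprod_subr eqKL)) M)
                     -> indm (incl (ucap_subl L K))
                          (resm (incl (ucap_subr L K)) M)},
    bijective f.
Proof.
move=> piK piM piL sL s_id.
set X := indm (incl (uprod_subr eqKL)) M.
set Y := indm (incl (ucap_subl L K)) (resm (incl (ucap_subr L K)) M).
pose c (q : aT * aT) (x : subvs_of (uprod eqKL)) : subvs_of K :=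
  vsproj K (pi (q.2 * vsval x)).
have cD q : {morph c q : x y / x + y}.
  by move=> x y; rewrite /c linearD /= mulrDr linearD linearD.
have cM q x (k : subvs_of K) : c q (x * incl (uprod_subr eqKL) k) = c q x * k.
  apply: val_inj; rewrite /c /=.
  by rewrite mulrA piM ?subvsP // !vsprojK ?piK // memvM ?subvsP.
pose phi (x : subvs_of (uprod eqKL)) (m : M) : Y :=
  \sum_(q <- s) indt (incl (ucap_subl L K)) (vsproj L q.1)
    (c q x *: m : resm (incl (ucap_subr L K)) M).
have [||| g gE] := @indm_lift _ _ (incl (uprod_subr eqKL)) M Y phi.
- move=> m x y; rewrite /phi -big_split; apply: eq_bigr => q _.
  by rewrite cD scalerDl indtDr.
- move=> x m n; rewrite /phi -big_split; apply: eq_bigr => q _.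
  by rewrite scalerDr indtDr.
- by move=> x k m; apply: eq_bigr => q _; rewrite cM scalerA.
pose psi (l : subvs_of L) (m : resm (incl (ucap_subr L K)) M) : X :=
  indt (incl (uprod_subr eqKL)) (incl (uprod_subl eqKL) l) (m : M).
have [||| h hE] := @indm_lift _ _ (incl (ucap_subl L K)) _ X psi.
- by move=> m l l'; rewrite /psi raddfD indtDl.
- by move=> l m n; rewrite /psi indtDr.
- move=> l b m; rewrite /psi -indt_bal; congr indt.
  by apply: val_inj.
(* Both sides are linear in x, so products l k suffice, where k comes out of pi on the right. *)
have s_idK x : x \in (L * K)%VS -> \sum_(q <- s) q.1 * pi (q.2 * x) = x.
  pose f : 'End(aT) := \sum_(q <- s) (amull q.1 \o pi \o amull q.2)%VF.
  have fE z : f z = \sum_(q <- s) q.1 * pi (q.2 * z).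
    by rewrite sum_lfunE; apply: eq_bigr => q _; rewrite !comp_lfunE !lfunE.
  move=> LKx; rewrite -fE -[RHS]id_lfunE; apply/eqlfunP.
  move: x LKx; apply/subvP/prodvP => l k Ll Kk; apply/eqlfunP.
  rewrite fE id_lfunE -[in RHS](s_id l) // mulr_suml; apply: eq_bigr => q _.
  by rewrite mulrA piM // mulrA.
have hK : cancel h g.
  apply: (@indm_ext _ _ _ _ Y (g \o h) idfun) => l m /=.
  rewrite hE gE /phi.
  pose b (q : aT * aT) : subvs_of (ucap L K) := vsproj _ (pi (q.2 * vsval l)).
  have bE q : q \in s -> vsval (b q) = pi (q.2 * vsval l).
    move=> /sL[_ Lq]; rewrite vsprojK // memv_cap piK andbT piL //.
    by rewrite memvM ?subvsP.
  (* Membership of q in s is kept because only then is pi (q.2 l) in the intersection, so that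
     [vsproj] does not alter it. *)
  rewrite big_seq; transitivity (\sum_(q <- s | q \in s)
    indt (incl (ucap_subl L K)) (vsproj L q.1 * incl (ucap_subl L K) (b q)) m).
    apply: eq_bigr => q sq; rewrite indt_bal; congr indt.
    rewrite -[RHS]/(incl (ucap_subr L K) (b q) *: (m : M)).
    suff -> : c q (incl (uprod_subl eqKL) l) = incl (ucap_subr L K) (b q) by [].
    by apply: val_inj; rewrite /= bE // vsprojK.
  rewrite -big_seq -indt_suml; congr indt; apply: val_inj.
  rewrite raddf_sum /= -[RHS]s_id ?subvsP //; apply: eq_big_seq => q sq.
  by rewrite /= bE // vsprojK //; case: (sL q sq).
have gK : cancel g h.
  apply: (@indm_ext _ _ _ _ X (h \o g) idfun) => x m /=.
  rewrite gE /phi raddf_sum.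
  transitivity (\sum_(q <- s) indt (incl (uprod_subr eqKL))
    (incl (uprod_subl eqKL) (vsproj L q.1) * incl (uprod_subr eqKL) (c q x))
    m).
    by apply: eq_bigr => q _; rewrite /= hE indt_bal.
  rewrite -indt_suml; congr indt; apply: val_inj.
  rewrite raddf_sum /= -[RHS]s_idK ?subvsP //; apply: eq_big_seq => q sq.
  by rewrite /= !vsprojK //; case: (sL q sq).
have hZ l w : h (l *: w) = incl (uprod_subl eqKL) l *: h w.
  have [t ->] := indmP w; rewrite ind_classE scaler_sumr !raddf_sum.
  apply: eq_bigr => q _; rewrite /= indtZ !hE /psi indtZ.
  by rewrite rmorphM.
(* L-linearity is evident for the natural map h and passes to its inverse g. *)
have g_lin : linear (g : resm (incl (uprod_subl eqKL)) X -> Y).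
  move=> l x z; rewrite raddfD; congr (_ + _).
  by rewrite -[RHS]hK hZ gK.
pose f : {linear resm (incl (uprod_subl eqKL)) X -> Y} :=
  HB.pack (g : resm (incl (uprod_subl eqKL)) X -> Y)
    (GRing.isLinear.Build (subvs_of L) (resm (incl (uprod_subl eqKL)) X) Y
       *:%R _ g_lin).
by exists f; exists h.
Qed.

Theorem cosemisimple_mackey (F : fieldType) (H : hopfAlgType F)
    (K L : usubalg H) (eqKL : (K * L = L * K)%VS)
    (M : lmodType (subvs_of K)) :
    cosemisimple H -> hopf_subalgebra K -> hopf_subalgebra L ->
  exists f : {linear resm (incl (uprod_subl eqKL))
                       (indm (incl (uprod_subr eqKL)) M)
                     -> indm (incl (ucap_subl L K))
                          (resm (incl (ucap_subr L K)) M)},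
    bijective f.
Proof.
move=> ssH K_hopf [subL antiL]; have [subK _] := K_hopf.
have [p [p1 p_mem p_comm pM]] := hopf_subalgebra_functional ssH K_hopf.
have [s sL s_id] := retraction_dual_basis p1 p_mem p_comm pM subL antiL.
apply: (@mackey_of_dual_basis _ _ _ _ _ (tau p 1) s) => //.
- exact: tau1_mem.
- by move=> h k Kk; apply: (tau1_mulr pM).
- by move=> l; apply: tau_mem.
Qed.

Theorem proposition3p4 (R : realType) (H : hopfAlgType R[i])
    (H_cosemisimple : cosemisimple H)
    (K L : usubalg H)
    (K_hopf : hopf_subalgebra K) (L_hopf : hopf_subalgebra L)
    (eqKL : (K * L = L * K)%VS)
    (M : lmodType (subvs_of K)) :
  exists f : {linear resm (incl (uprod_subl eqKL))
                       (indm (incl (uprod_subr eqKL)) M)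
                     -> indm (incl (ucap_subl L K))
                          (resm (incl (ucap_subr L K)) M)},
    bijective f.
Proof. exact: cosemisimple_mackey. Qed.
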